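(* Let $\mathcal{I}$ be an ideal on $\mathbb{N}$ and let $D$ be a discrete space with $|D|=\mathfrak{c}$. If $\mathcal{I}$ is a Baire ideal for $D^{\mathbb{N}}$ (with the product topology), then $\mathcal{I}$ is a Baire ideal, i.e. a Baire ideal for every complete metric space.
   Context: An ideal on $\mathbb{N}$ is a family $\mathcal{I}\subset\mathcal{P}(\mathbb{N})$ with $\mathbb{N}\notin\mathcal{I}$, closed under subsets and finite unions; every ideal is assumed to contain the family of all finite subsets of $\mathbb{N}$. For a topological space $X$, $\mathrm{NWD}(X)$ is the family of nowhere dense subsets of $X$. $\mathcal{I}$ is a Baire ideal for $X$ if for every monotonic $f\colon\mathcal{I}\to\mathrm{NWD}(X)$ (i.e. $A\subset B$ implies $f(A)\subset f(B)$) one has $\bigcup\{f(A):A\in\mathcal{I}\}\neq X$. Metric spaces are assumed nonempty. $\mathfrak{c}$ is the cardinality of the continuum. *)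

(* Defs.v *)
From HB Require Import structures.
From mathcomp Require Import all_boot all_order all_algebra.
From mathcomp Require Import all_classical all_reals topology.
From mathcomp Require Import metric_structure.

Set Implicit Arguments.
Unset Strict Implicit.
Unset Printing Implicit Defensive.

Local Open Scope classical_set_scope.

Record is_ideal (I : set (set nat)) : Prop := IsIdeal {
  ideal_proper : ~ I setT;
  ideal_finite : forall A, finite_set A -> I A;
  ideal_subset : forall A B, A `<=` B -> I B -> I A;
  ideal_setU : forall A B, I A -> I B -> I (A `|` B)
}.

Definition nowhere_dense (X : topologicalType) (A : set X) : Prop :=
  interior (closure A) = set0.

(** A map [I -> NWD(X)] is represented by a total function [set nat -> set X]
    whose values outside [I] are never constrained or used. *)
Definition baire_ideal_for (X : topologicalType) (I : set (set nat)) : Prop :=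
  forall f : set nat -> set X,
    (forall A, I A -> nowhere_dense (f A)) ->
    (forall A B, I A -> I B -> A `<=` B -> f A `<=` f B) ->
    \bigcup_(A in I) f A <> setT.

(** Like [completePseudoMetricType], this structure is pointed, so the spaces
    are nonempty. *)
#[short(type="completeMetricType")]
HB.structure Definition CompleteMetric (R : numDomainType) :=
  { M of CompletePseudoMetric R M & Metric R M }.

Definition baire_ideal (R : realType) (I : set (set nat)) : Prop :=
  forall M : completeMetricType R, baire_ideal_for M I.

(* Main.v *)
(** Since [D] has at least as many points as there are sets of naturals, fix a
    surjection [e] from [D] onto the power set of the naturals.  Given a monotone
    [f : I -> NWD(M)], choose a scheme of balls indexed by finite sequences in
    [D]: the radii halve, and the child of a ball along [d] avoids [f (e d)]
    whenever [e d] is in [I].  Completeness yields [phi : D^N -> M] sending a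
    branch to a common point of (the closures of) its balls.  Every cylinder
    contains the smaller cylinder extended by some [d] with [e d = A], whose
    image under [phi] misses [f A]; so [phi @^-1` f A] is nowhere dense, and a
    cover of [M] by [f] would pull back to a cover of [D^N]. *)

Require Import Defs.
From mathcomp Require Import all_boot all_order all_algebra.
From mathcomp Require Import all_classical all_reals topology.
From mathcomp Require Import interval_inference pseudometric_normed_Zmodule.
From mathcomp Require Import lra.

Import Order.TTheory GRing.Theory Num.Theory.
Import numFieldTopology.Exports.

Local Open Scope classical_set_scope.

Section ternary.
Context {R : realType}.
Local Open Scope ring_scope.
Implicit Types A B : set nat.

Definition ternary_sum A n : R := \sum_(i < n) ((i : nat) \in A)%:R * 3^-1 ^+ i.

(** Embeds the power set of [nat] in the reals: in base 3, expansions with digits 0 and 1 only are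
    unique. *)
Definition ternary A : R := sup (range (ternary_sum A)).

Lemma ternary_sumS A n :
  ternary_sum A n.+1 = ternary_sum A n + (n \in A)%:R * 3^-1 ^+ n.
Proof. by rewrite /ternary_sum big_ord_recr. Qed.

(** The term with [3 / 2] is the full geometric tail from [n] on. Partial sums increase, and partial
    sums plus tail decrease. *)
Lemma ternary_sum_le A m n :
  ternary_sum A m <= ternary_sum A n + 3 / 2 * 3^-1 ^+ n.
Proof.
have pow_ge0 k : 0 <= (3^-1 : R) ^+ k by rewrite exprn_ge0// invr_ge0.
pose up k := ternary_sum A k + 3 / 2 * 3^-1 ^+ k.
have lo_up k : ternary_sum A k <= up k by have := pow_ge0 k; rewrite /up; lra.
have lo_mono : {homo ternary_sum A : k l / (k <= l)%N >-> k <= l}.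
  apply: homo_leq => [//|y x z|k]; first exact: le_trans.
  by rewrite ternary_sumS lerDl mulr_ge0.
have up_mono : {homo up : k l / (k <= l)%N >-> l <= k}.
  apply: (@homo_leq _ _ (fun x y => y <= x)) => [//|y x z xy yz|k].
    exact: le_trans yz xy.
  rewrite /up ternary_sumS exprS; have := pow_ge0 k.
  by case: (k \in A) => /=; lra.
by have [mn|/ltnW nm] := leqP m n;
  [exact: le_trans (lo_mono _ _ mn) (lo_up n)
  |exact: le_trans (lo_up m) (up_mono _ _ nm)].
Qed.

Lemma ternary_ge A n : ternary_sum A n <= ternary A.
Proof.
apply: ub_le_sup; last by exists n.
by exists (ternary_sum A 0 + 3 / 2 * 3^-1 ^+ 0) => _ [m _ <-]; exact: ternary_sum_le.
Qed.

Lemma ternary_le A n : ternary A <= ternary_sum A n + 3 / 2 * 3^-1 ^+ n.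
Proof.
apply: ge_sup; first by exists (ternary_sum A 0); exists 0%N.
by move=> _ [m _ <-]; exact: ternary_sum_le.
Qed.

(** At the first index [n] where two sets differ, the digit contributes [3^-1 ^+ n], while all later
    digits together contribute at most half of that. *)
Lemma ternary_inj : injective ternary.
Proof.
suff lt_ternary A B n : (forall i, (i < n)%N -> (i \in A) = (i \in B)) ->
    n \in A -> n \notin B -> ternary B < ternary A.
  move=> A B AB; suff eqAB n : (n \in A) = (n \in B).
    by apply/seteqP; split=> n /mem_set nX; apply/set_mem; rewrite ?eqAB// -eqAB.
  elim/ltn_ind: n => n IHn; apply/idP/idP => nX; apply/negPn/negP => nY.
    by have := lt_ternary A B n IHn nX nY; rewrite AB ltxx.
  have := lt_ternary B A n (fun i lin => esym (IHn i lin)) nX nY.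
  by rewrite AB ltxx.
move=> eqAB nA /negPf nB.
have sAB : ternary_sum A n = ternary_sum B n.
  by apply: eq_bigr => i _; rewrite eqAB.
have := ternary_ge A n.+1; have := ternary_le B n.+1.
have : 0 < (3^-1 : R) ^+ n by rewrite exprn_gt0// invr_gt0.
rewrite !ternary_sumS nA nB sAB exprS /=; lra.
Qed.

End ternary.

Section balls.
Context {R : realType}.
Local Open Scope ring_scope.

(** The centres are Cauchy, since from index [n] on they stay in the [n]-th ball. Their limit may
    leave the open balls, hence the closures. *)
Lemma nested_balls_nonempty {M : completePseudoMetricType R}
    (x : nat -> M) (r : nat -> {posnum R}) :
  (forall n, ball (x n.+1) (r n.+1)%:num `<=` ball (x n) (r n)%:num) ->
  (forall n, (r n.+1)%:num <= (r n)%:num / 2) ->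
  exists l, forall n, closure (ball (x n) (r n)%:num) l.
Proof.
move=> nest halve.
have sub m n : (m <= n)%N -> ball (x n) (r n)%:num `<=` ball (x m) (r m)%:num.
  elim: n => [|n IHn]; first by rewrite leqn0 => /eqP ->.
  by rewrite leq_eqVlt => /predU1P[->//|/IHn]; exact: (subset_trans (nest n)).
have tail n : \forall m \near \oo, ball (x n) (r n)%:num (x m).
  by exists n => // m /sub; apply; exact: ballxx.
have small e : (0 < e) -> exists n, ((r n)%:num <= e).
  move=> e0.
  have bound n : ((r n)%:num * 2 ^+ n <= (r 0)%:num).
    elim: n => [|n IHn]; first by rewrite expr0 mulr1.
    apply: le_trans IHn; rewrite exprS mulrA ler_pM2r ?exprn_gt0//.
    by rewrite -ler_pdivlMr.
  (* This works because [2 ^+ n] is at least [n + 1], which exceeds the quotient. *)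
  pose n := Num.trunc ((r 0%N)%:num / e).
  exists n; rewrite -(ler_pM2r (x := 2 ^+ n)) ?exprn_gt0//.
  apply: le_trans (bound n) _; rewrite mulrC -ler_pdivrMr//.
  apply: le_trans (ltW (truncnS_gt _)) _.
  by rewrite -natrX ler_nat ltn_expl.
have : cvg (x @ \oo).
  apply/cauchy_cvgP/cauchy_exP => e /small[n rn].
  by exists (x n); near=> m; apply: le_ball rn _ _; near: m; exact: tail.
move=> xl; exists (lim (x @ \oo)) => n U /xl xU.
have [m [xm Um]] := filter_ex (filterI (tail n) xU).
by exists (x m).
Unshelve. all: by end_near. Qed.

Lemma nowhere_dense_ball {M : pseudoMetricType R} (A : set M)
    (x : M) (r : {posnum R}) : nowhere_dense A ->
  exists (y : M) (s : {posnum R}), [/\ closure (ball y s%:num) `<=` ~` A,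
    ball y s%:num `<=` ball x r%:num & (s%:num <= r%:num / 2)].
Proof.
move=> nwdA.
have [y xy Ay] : exists2 y, ball x (r%:num / 2) y & ~ closure A y.
  apply: contrapT => noy; suff : interior (closure A) x by rewrite nwdA.
  apply/nbhs_ballP; exists (r%:num / 2) => //= y xy.
  by apply: contrapT => Ay; apply: noy; exists y.
have [e e0 yeA] : exists2 e : R, (0 < e) & ball y e `<=` ~` A.
  have /nbhs_ballP[e e0 yeA] : nbhs y (~` closure A).
    by apply: open_nbhs_nbhs; split=> //; exact/closed_openC/closed_closure.
  by exists e => // z /yeA; apply: contra_not; exact: subset_closure.
(* At most [e / 2], to keep the closure inside [ball y e]; at most [r / 2], to stay inside
   [ball x r], as [y] is within [r / 2] of [x]. *)
exists y, (Num.min (PosNum e0)%:num r%:num / 2)%:pos => /=; split.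
- apply: subset_trans yeA; apply: subset_trans (subset_closure_half e0).
  apply: closure_subset; apply: le_ball.
  by rewrite ler_pM2r// ge_min lexx.
- rewrite [r%:num in X in _ `<=` X]splitr => z yz; apply: ball_triangle xy _.
  by apply: le_ball yz; rewrite ler_pM2r// ge_min lexx orbT.
- by rewrite ler_pM2r// ge_min lexx orbT.
Qed.

End balls.

Definition cylinder {D : Type} (a : nat -> D) n : set (nat -> D) :=
  [set b | forall i, (i < n)%N -> b i = a i].

Lemma cylinder_sub_nbhs {D : topologicalType}
    (a : prod_topology (fun _ : nat => D)) (U : set (nat -> D)) :
  nbhs a U -> exists n, cylinder a n `<=` U.
Proof.
pose F : set_system (prod_topology (fun _ : nat => D)) :=
  filter_from [set: nat] (cylinder a).
have FF : Filter F.
  apply: filter_from_filter => [|m n _ _]; first by exists 0%N.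
  exists (maxn m n) => // b ba.
  by split=> i lti; apply: ba; rewrite leq_max lti ?orbT.
(* The product topology is a supremum over the coordinates, so convergence is checked at each [i],
   where a cylinder of length [i.+1] suffices. *)
have : F --> a.
  apply/cvg_sup => i V [W [[O oO <-] Oa] /filterS]; apply.
  by exists i.+1 => // b ba; rewrite /preimage /= ba.
by move=> /[apply] -[n _ nU]; exists n.
Qed.

Theorem corollary3p5 (R : realType) (I : set (set nat))
    (D : discreteTopologicalType) :
  is_ideal I ->
  ([set: D] #= [set: R])%card ->
  baire_ideal_for (prod_topology (fun _ : nat => D)) I ->
  baire_ideal R I.
Proof.
move=> idI cardD baireD M f nwdf monof covf.
have [e surj_e] : exists e : D -> set nat, forall A, exists d, e d = A.
  have [h [_ _ surj_h]] := @card_set_bijP D R _ _ cardD.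
  (* [get] inverts [ternary] on its range; its default elsewhere is harmless, as only surjectivity
     is claimed. *)
  exists (fun d => get [set A | ternary A = h d]) => A.
  have [d _ hd] := surj_h (ternary A) Logic.I.
  exists d; apply: (@ternary_inj R).
  by rewrite (@getPex _ [set B | ternary B = h d]) ?hd//; exists A.
have [step stepP] : exists step : M * {posnum R}%R -> set nat -> M * {posnum R}%R,
    forall p A, ([/\ I A -> closure (ball (step p A).1 (step p A).2%:num) `<=` ~` f A,
      ball (step p A).1 (step p A).2%:num `<=` ball p.1 p.2%:num &
      (step p A).2%:num <= p.2%:num / 2])%R.
  have step1 (pA : (M * {posnum R}%R) * set nat) : exists q : M * {posnum R}%R,
      ([/\ I pA.2 -> closure (ball q.1 q.2%:num) `<=` ~` f pA.2,
        ball q.1 q.2%:num `<=` ball pA.1.1 pA.1.2%:num &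
        q.2%:num <= pA.1.2%:num / 2])%R.
    case: pA => -[x r] A /=.
    have [IA|nIA] := pselect (I A).
      by have [y [s [sA sx sr]]] := nowhere_dense_ball _ x r (nwdf _ IA); exists (y, s).
    (* Outside [I] the ball only has to shrink; the nowhere dense set [f set0] provides such a
       ball. *)
    have I0 := ideal_finite idI (finite_set0 nat).
    by have [y [s [_ sx sr]]] := nowhere_dense_ball _ x r (nwdf _ I0); exists (y, s).
  have [g gP] := choice step1.
  by exists (fun p A => g (p, A)) => p A; exact: (gP (p, A)).
pose node := fix node (a : nat -> D) n :=
  if n is m.+1 then step (node a m) (e (a m)) else (point, PosNum ltr01).
have lim_node a : exists l : M,
    forall n, closure (ball (node a n).1 (node a n).2%:num%R) l.
  by apply: nested_balls_nonempty => n; have [_ ? ?] := stepP (node a n) (e (a n)).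
have [phi phiP] := choice lim_node.
apply: (baireD (fun A => phi @^-1` f A)).
- move=> A IA; apply/seteqP; split=> // a aA.
  have [d edA] := surj_e A.
  have [m mA] := cylinder_sub_nbhs _ _ aA.
  (* Agreeing with [a] below [m] puts [b] in the closure of the preimage; [d] at [m] triggers the
     step avoiding [f A]. *)
  pose b i := if (i < m)%N then a i else d.
  have nbhs_bm : nbhs (b : prod_topology (fun=> D)) [set c | c m = d].
    have := @proj_continuous nat (fun=> D) m b _ (discrete_set1 (b m)).
    by rewrite /b ltnn; exact.
  have ab : cylinder a m b by move=> i im; rewrite /b im.
  (* Only [c m = d] matters: whatever ball [node c m] is, the closure of its child along [d] misses
     [f A] but contains [phi c]. *)
  have [c [fAc cm]] := mA b ab _ nbhs_bm.
  have [/(_ IA) disj _ _] := stepP (node c m) A.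
  apply: disj fAc => /=.
  by rewrite -edA -cm; exact: (phiP c m.+1).
- by move=> A B IA IB AB a; exact: monof.
- apply/seteqP; split=> // a _.
  have : (\bigcup_(A in I) f A) (phi a) by rewrite covf.
  by case=> A IA fA; exists A.
Qed.
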